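(* Let $p,q\ge 0$ be integers with $n=p+q\ge 1$, let $Y$ be a metric space, and let $\mathcal{C}(Y;\mathbb{R}_{p,q})$ denote the set of all continuous functions from $Y$ to the Clifford algebra $\mathbb{R}_{p,q}$ (with its topology as a finite-dimensional real vector space). Let $B\subset \mathcal{C}(Y;\mathbb{R}_{p,q})$ be a subset such that $B$ contains the constant function $1$ and $B$ separates the points of $Y$ (for all $x\neq y$ in $Y$ there is $f\in B$ with $f(x)\neq f(y)$). If $n$ is odd, assume in addition that $B$ is stable under the principal automorphism, i.e. $f\in B$ implies $f_*\in B$, where $f_*(y)=(f(y))_*$. Let $A_B(Y;\mathbb{R}_{p,q})$ be the algebra generated by $B$, i.e. the smallest real subalgebra of $\mathcal{C}(Y;\mathbb{R}_{p,q})$ (under pointwise addition and Clifford multiplication) containing $B$ and all constant functions $Y\to\mathbb{R}_{p,q}$. Then $A_B(Y;\mathbb{R}_{p,q})$ is dense in $\mathcal{C}(Y;\mathbb{R}_{p,q})$ for the topology of uniform convergence on compact subsets of $Y$.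
   Context: $\mathbb{R}_{p,q}$ is the universal real Clifford algebra of $\mathbb{R}^n$, $n=p+q$, with basis $\{e_A\}$ indexed by strictly increasing multi-indices $A=(a_1<\dots<a_k)\subset\{1,\dots,n\}$ (with $e_\emptyset=1$, $e_A=e_{a_1}\cdots e_{a_k}$), subject to $e_i^2=1$ for $1\le i\le p$, $e_i^2=-1$ for $p+1\le i\le n$, and $e_ie_j=-e_je_i$ for $i\neq j$. Every $a\in\mathbb{R}_{p,q}$ decomposes as $a=\sum_{k=0}^n\langle a\rangle_k$ with $\langle a\rangle_k=\sum_{|A|=k}a_Ae_A$, $a_A\in\mathbb{R}$. The principal automorphism is $a_*=\sum_{k=0}^n(-1)^k\langle a\rangle_k$. *)

(* Defs.v *)
From HB Require Import structures.
From mathcomp Require Import all_boot all_order all_algebra.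
From mathcomp Require Import all_classical all_reals all_analysis.
Set Implicit Arguments. Unset Strict Implicit. Unset Printing Implicit Defensive.
Import Order.TTheory GRing.Theory Num.Theory.
Import numFieldNormedType.Exports.
Local Open Scope ring_scope.

(* The universal real Clifford algebra R_{p,q}, n = p + q, represented by its
   coefficient vector in the basis (e_A), A ranging over subsets of {0,..,n-1}
   (a subset corresponds to the strictly increasing multi-index of its elements).
   Generators e_i with i < p square to 1, those with p <= i < n square to -1. *)
Definition clif (R : realType) (n : nat) := {ffun {set 'I_n} -> R}.

(* e_A e_B = clif_sign p A B * e_(A symmetric-difference B):
   (-1)^(#{(a,b) in A x B | b < a}) * prod_{i in A :&: B} e_i^2 . *)
Definition clif_sign (R : realType) (p n : nat) (A B : {set 'I_n}) : R :=
  (-1) ^+ (#|[pred ab : 'I_n * 'I_n | ((ab.1 \in A) && (ab.2 \in B) && (ab.2 < ab.1)%N)]|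
           + #|[pred i in A :&: B | (p <= i)%N]|).

Definition clif_mul (R : realType) (p n : nat) (a b : clif R n) : clif R n :=
  [ffun C : {set 'I_n} => \sum_(A : {set 'I_n}) \sum_(B : {set 'I_n} | (A :\: B) :|: (B :\: A) == C)
               clif_sign R p A B * a A * b B].

Definition clif_add (R : realType) (n : nat) (a b : clif R n) : clif R n :=
  [ffun A => a A + b A].

Definition clif_one (R : realType) (n : nat) : clif R n :=
  [ffun A : {set 'I_n} => if A == finset.set0 then 1 else 0].

Definition clif_star (R : realType) (n : nat) (a : clif R n) : clif R n :=
  [ffun A : {set 'I_n} => (-1) ^+ #|A| * a A].

Definition clif_norm (R : realType) (n : nat) (a : clif R n) : R :=
  \big[Num.max/0]_(A : {set 'I_n}) `|a A|.

(* continuity of f : Y -> R_{p,q} for the (unique) vector-space topology,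
   i.e. the product topology on coefficients *)
Definition clif_continuous (R : realType) (Y : topologicalType) (n : nat)
  (f : Y -> clif R n) : Prop :=
  forall A : {set 'I_n}, continuous (fun y => f y A).

(* the real algebra A_B generated by B and all constant functions: smallest set of
   functions containing B and the constants and closed under pointwise addition and
   Clifford multiplication (real scalar multiples are products with constants). *)
Definition gen_algebra (R : realType) (p n : nat) (Y : Type)
  (B : (Y -> clif R n) -> Prop) (g : Y -> clif R n) : Prop :=
  forall S : (Y -> clif R n) -> Prop,
    (forall f, B f -> S f) ->
    (forall c : clif R n, S (fun _ => c)) ->
    (forall f h, S f -> S h -> S (fun y => clif_add (f y) (h y))) ->
    (forall f h, S f -> S h -> S (fun y => clif_mul p (f y) (h y))) ->
    S g.

(* Main.v *)
(* Averaging e_D^-1 a e_D over all multi-indices D multiplies the coefficient of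
   e_C in a by the mean of the character D |-> e_C^-1 e_D^-1 e_C e_D = +-1, which
   vanishes unless e_C is central, that is unless C is empty or C is full and n
   is odd. So when n is even, averaging e_A^-1 f puts the A-coordinate of f, as
   a scalar function, in the algebra generated by B; when n is odd the same works
   after the principal automorphism has been used to kill the full coordinate.
   The coordinates of the elements of B separate points, so the real
   Stone-Weierstrass theorem applies to the scalar functions of the algebra. *)

Require Import Defs.
From HB Require Import structures.
From mathcomp Require Import all_boot all_order all_algebra.
From mathcomp Require Import all_classical all_reals all_analysis.
From mathcomp Require Import ring lra.
Set Implicit Arguments.
Unset Strict Implicit.
Unset Printing Implicit Defensive.
Import Order.TTheory GRing.Theory Num.Theory.
Import numFieldNormedType.Exports.
Local Open Scope ring_scope.
Local Open Scope classical_set_scope.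

(** * The real Stone-Weierstrass theorem *)

(** Each point of [K] has a local majorant in [P], and a maximum of finitely many of them majorizes
    [f] on [K]. The near-covering form of compactness does the work of a finite subcover. *)
Lemma compact_lt_max_closed (R : realType) (Y : topologicalType)
  (P : (Y -> R) -> Prop) (K : set Y) (f : Y -> R) :
  compact K -> (exists g, P g) ->
  (forall g h, P g -> P h -> P (fun y => Num.max (g y) (h y))) ->
  (forall x, K x -> exists2 g, P g & \forall y \near x, f y < g y) ->
  exists2 g, P g & forall y, K y -> f y < g y.
Proof.
move=> cK [g0 Pg0] Pmax Pnear.
(* Closure under max makes the upper cones of P a filter base. *)
pose F := [set S : set (Y -> R) |
  exists2 g, P g & forall h, P h -> (forall y, g y <= h y) -> S h].
have FF : Filter F.
  split.
  - by exists g0.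
  - move=> S T [g Pg gS] [h Ph hT]; exists (fun y => Num.max (g y) (h y)).
      exact: Pmax.
    move=> k Pk gk; split.
      by apply: gS => // y; apply: le_trans (gk y); rewrite le_max lexx.
    by apply: hT => // y; apply: le_trans (gk y); rewrite le_max lexx orbT.
  - by move=> S T ST [g Pg gS]; exists g => // h Ph gh; apply/ST/gS.
have [] := (compact_near_coveringP K).1 cK (Y -> R) F (fun g y => f y < g y) FF.
  move=> x Kx; have [g Pg fg] := Pnear x Kx.
  exists ([set y | f y < g y], [set h | forall y, g y <= h y]) => /=.
    by split=> //; exists g.
  by move=> [y h] /= [fgy gh]; apply: lt_le_trans (gh y).
by move=> g Pg gK; exists g => // y Ky; exact: gK.
Qed.

Lemma compact_gt_min_closed (R : realType) (Y : topologicalType)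
  (P : (Y -> R) -> Prop) (K : set Y) (f : Y -> R) :
  compact K -> (exists g, P g) ->
  (forall g h, P g -> P h -> P (fun y => Num.min (g y) (h y))) ->
  (forall x, K x -> exists2 g, P g & \forall y \near x, g y < f y) ->
  exists2 g, P g & forall y, K y -> g y < f y.
Proof.
move=> cK [g0 Pg0] Pmin Pnear.
have NN (h : Y -> R) : (fun y => - - h y) = h by apply/funext => y; rewrite opprK.
have [|g h Pg Ph|x Kx|g Pg gK] :=
  @compact_lt_max_closed R Y (fun g => P (fun y => - g y)) K (fun y => - f y) cK.
- by exists (fun y => - g0 y); rewrite NN.
- have -> : (fun y => - Num.max (g y) (h y)) = (fun y => Num.min (- g y) (- h y)).
    by apply/funext => y; rewrite oppr_max.
  exact: Pmin.
- have [g Pg gf] := Pnear x Kx; exists (fun y => - g y); first by rewrite NN.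
  by apply: filterS gf => y; rewrite ltrN2.
by exists (fun y => - g y) => // y /gK; rewrite ltrNl.
Qed.

(* Iteration for the fixed point q = |t| of q |-> q + (t^2 - q^2) / 2. *)
Fixpoint abs_approx (R : realType) (t : R) (n : nat) : R :=
  if n is m.+1 then abs_approx t m + (t ^+ 2 - abs_approx t m ^+ 2) / 2 else 0.

(** One iteration multiplies the error by [1 - (|t| + q) / 2], which is at most [1 - |t| / 2]. Since
    [(1 - |t| / 2) (2 + (n + 1) |t|) <= 2 + n |t|], the last bound propagates; it yields a rate
    uniform in [t]. *)
Lemma abs_approx_bounds (R : realType) (t : R) (n : nat) : `|t| <= 1 ->
  [/\ 0 <= abs_approx t n, abs_approx t n <= `|t| &
      (`|t| - abs_approx t n) * (2 + n%:R * `|t|) <= 2 * `|t|].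
Proof.
have -> m : abs_approx t m = abs_approx `|t| m.
  by elim: m => //= m ->; rewrite real_normK ?num_real.
have := normr_ge0 t; move: `|t| => a a0 a1.
elim: n => [|n [q0 qa IH]] /=; first by split=> //; rewrite mul0r; lra.
set q := abs_approx a n in q0 qa IH *.
have dE : a - (q + (a ^+ 2 - q ^+ 2) / 2) = (a - q) * (1 - (a + q) / 2) by field.
have d0 : 0 <= a - q by lra.
have h0 : 0 <= 1 - (a + q) / 2 by lra.
split.
- by apply: addr_ge0 => //; apply: divr_ge0 => //; rewrite subr_ge0 lerXn2r// ?nnegrE.
- by rewrite -subr_ge0 dE mulr_ge0.
rewrite dE; apply: le_trans IH.
rewrite -mulrA ler_wpM2l//.
have n0 : 0 <= n%:R :> R by [].
apply: (@le_trans _ _ ((1 - a / 2) * (2 + n.+1%:R * a))).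
  by rewrite ler_wpM2r ?addr_ge0 ?mulr_ge0//; lra.
rewrite -(natr1 n); move: n0; clear -a0 a1; move: n%:R => N N0.
have : 0 <= (N + 1) * (a * a) by rewrite !mulr_ge0// addr_ge0.
nra.
Qed.

Lemma abs_approx_le (R : realType) (t : R) (n : nat) : `|t| <= 1 -> (0 < n)%N ->
  `| `|t| - abs_approx t n| <= 2 / n%:R.
Proof.
move=> t1 n0; have [q0 qa H] := abs_approx_bounds n t1.
have N0 : 0 < n%:R :> R by rewrite ltr0n.
rewrite ger0_norm ?subr_ge0// ler_pdivlMr//.
move: (normr_ge0 t) q0 qa H N0; move: `|t| (abs_approx t n) n%:R => a q N.
(* The factor [|t|] is cancelled from the bound, so [|t| = 0], where the iterate vanishes, is
   treated apart. *)
rewrite le_eqVlt => /orP[/eqP <- q0 qa _ _|a0 q0 qa H N0].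
  have -> : q = 0 by lra.
  by rewrite subrr mul0r.
by rewrite -(ler_pM2r a0); nra.
Qed.

Section stone_weierstrass.
Context (R : realType) (Y : topologicalType) (K : set Y) (A : (Y -> R) -> Prop).
Hypotheses (cK : compact K) (A_cont : forall g, A g -> continuous g)
  (A_cst : forall c : R, A (fun _ => c))
  (A_add : forall g h, A g -> A h -> A (fun y => g y + h y))
  (A_mul : forall g h, A g -> A h -> A (fun y => g y * h y)).

(** The uniform closure of [A] on [K]. Unlike [A] itself, it is always stable under max and min. *)
Let Cl (h : Y -> R) :=
  forall e : R, 0 < e -> exists2 g, A g & forall y, K y -> `|h y - g y| < e.

Let Cl_A g : A g -> Cl g.
Proof. by move=> Ag e e0; exists g => // y _; rewrite subrr normr0. Qed.

Let Cl_add g h : Cl g -> Cl h -> Cl (fun y => g y + h y).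
Proof.
move=> Cg Ch e e0; have e20 : 0 < e / 2 by lra.
have [g' Ag gg] := Cg _ e20; have [h' Ah hh] := Ch _ e20.
exists (fun y => g' y + h' y); first exact: A_add.
move=> y Ky; rewrite opprD addrACA (le_lt_trans (ler_normD _ _))//.
by have := gg y Ky; have := hh y Ky; lra.
Qed.

Let Cl_scale c g : Cl g -> Cl (fun y => c * g y).
Proof.
move=> Cg e e0; have c0 : 0 < `|c| + 1 by rewrite ltr_wpDl.
have [g' Ag gg] := Cg (e / (`|c| + 1)) (divr_gt0 e0 c0).
exists (fun y => c * g' y); first exact: A_mul.
move=> y Ky; rewrite -mulrBr normrM.
have := gg y Ky; rewrite ltr_pdivlMr// => /(le_lt_trans _); apply.
by rewrite mulrC ler_wpM2l// lerDl.
Qed.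

Let Cl_abs h : Cl h -> Cl (fun y => `|h y|).
Proof.
move=> Ch e e0; have e20 : 0 < e / 2 by lra.
have [g Ag hg] := Ch _ e20.
have [M M0 gM] : exists2 M, 0 < M & forall y, K y -> `|g y| <= M.
  have /compact_bounded[M [_ bM]] :=
    continuous_compact (continuous_subspaceT (A_cont Ag)) cK.
  (* [compact_bounded] guarantees only bounds strictly above [M]; this one is also positive. *)
  exists (`|M| + 1); first by rewrite ltr_wpDl.
  move=> y Ky; apply: bM; last by exists y.
  by rewrite (le_lt_trans (ler_norm M))// ltrDl.
(* Dividing [g] by [M] brings it into the interval [-1, 1] on [K]; this [n] makes the rescaled error
   [M * (2 / n)] less than [e / 2]. *)
pose n := (Num.truncn (2 * M / (e / 2))).+1.
pose q y := M * abs_approx (M^-1 * g y) n.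
have Aq : A q.
  apply: A_mul => //; rewrite /n; elim: _.+1 => [|m IH] /=; first exact: A_cst.
  have At : A (fun y => M^-1 * g y) by exact: A_mul.
  apply: A_add => //; apply: A_mul => //; apply: A_add.
    exact: (A_mul At At).
  have -> : (fun y => - abs_approx (M^-1 * g y) m ^+ 2) =
            (fun y => -1 * (abs_approx (M^-1 * g y) m * abs_approx (M^-1 * g y) m)).
    by apply/funext => y; rewrite mulN1r.
  by apply: A_mul => //; exact: A_mul.
exists q => // y Ky.
have -> : `|h y| - q y = (`|h y| - `|g y|) + (`|g y| - q y) by ring.
rewrite (le_lt_trans (ler_normD _ _))//.
have h1 : `| `|h y| - `|g y| | < e / 2.
  by rewrite (le_lt_trans _ (hg y Ky))// ler_dist_dist.
have h2 : `| `|g y| - q y| < e / 2.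
  have -> : `|g y| - q y = M * (`|M^-1 * g y| - abs_approx (M^-1 * g y) n).
    rewrite mulrBr normrM (gtr0_norm (_ : 0 < M^-1)) ?invr_gt0// mulrA.
    by rewrite divff ?gt_eqF// mul1r.
  rewrite normrM (gtr0_norm M0).
  have t1 : `|M^-1 * g y| <= 1.
    by rewrite normrM gtr0_norm ?invr_gt0// ler_pdivrMl// mulr1 gM.
  have := abs_approx_le t1 (isT : (0 < n)%N).
  rewrite -(ler_pM2l M0) => /le_lt_trans; apply.
  have : 2 * M / (e / 2) < n%:R by exact: truncnS_gt.
  by rewrite ltr_pdivrMr// => nM; rewrite mulrA ltr_pdivrMr ?ltr0n//; lra.
lra.
Qed.

Let Cl_max g h : Cl g -> Cl h -> Cl (fun y => Num.max (g y) (h y)).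
Proof.
move=> Cg Ch.
have -> : (fun y => Num.max (g y) (h y)) =
          (fun y => 2^-1 * ((g y + h y) + `|g y + -1 * h y|)).
  by apply/funext => y; rewrite maxr_absE mulrC mulN1r.
apply: Cl_scale; apply: Cl_add; first exact: Cl_add.
by apply: Cl_abs; apply: Cl_add => //; exact: Cl_scale.
Qed.

Let Cl_min g h : Cl g -> Cl h -> Cl (fun y => Num.min (g y) (h y)).
Proof.
move=> Cg Ch.
have -> : (fun y => Num.min (g y) (h y)) =
          (fun y => -1 * Num.max (-1 * g y) (-1 * h y)).
  by apply/funext => y; rewrite !mulN1r oppr_max !opprK.
by apply: Cl_scale; apply: Cl_max; exact: Cl_scale.
Qed.

(** Lattice argument: interpolate [f] at two points [x] and [z], take maxima over [z] to stay above
    [f - e3] on [K], then minima over [x] to come below [f + e3]. *)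
Theorem stone_weierstrass (f : Y -> R) :
  (forall x y, K x -> K y -> x <> y -> exists2 g, A g & g x <> g y) ->
  continuous f -> Cl f.
Proof.
move=> sep cf e e0.
have interp x y : K x -> K y -> exists g, [/\ A g, g x = f x & g y = f y].
  move=> Kx Ky; have [<-|xy] := pselect (x = y).
    by exists (fun _ => f x); split.
  have [h Ah hxy] := sep x y Kx Ky xy.
  exists (fun z => f x + (f y - f x) / (h y - h x) * (h z + - h x)); split.
  - by apply: A_add => //; apply: A_mul => //; exact: A_add.
  - by rewrite subrr mulr0 addr0.
  - rewrite divfK; first by rewrite addrC subrK.
    by rewrite subr_eq0; apply/eqP => /esym.
pose e3 := e / 3; have e30 : 0 < e3 by rewrite /e3; lra.
(* [Cl] constrains a function only on [K], whereas strict inequalities spread to neighbourhoods in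
   [Y] by continuity. *)
pose L (g : Y -> R) := Cl g /\ continuous g.
have Lmax g h : L g -> L h -> L (fun y => Num.max (g y) (h y)).
  move=> [Cg cg] [Ch ch]; split; first exact: Cl_max.
  by move=> y; exact: continuous_max (cg y) (ch y).
have Lmin g h : L g -> L h -> L (fun y => Num.min (g y) (h y)).
  move=> [Cg cg] [Ch ch]; split; first exact: Cl_min.
  by move=> y; exact: continuous_min (cg y) (ch y).
have LA g : A g -> L g by move=> Ag; split; [exact: Cl_A|exact: A_cont].
have near_lt (g h : Y -> R) x : continuous g -> continuous h -> g x < h x ->
    \forall y \near x, g y < h y.
  move=> cg ch gh.
  have : (fun y => h y - g y) @ x --> h x - g x by apply: cvgB; [exact: ch|exact: cg].
  move/cvgr_gt => /(_ 0); rewrite subr_gt0 => /(_ gh).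
  by apply: filterS => y; rewrite subr_gt0.
have cfD c : continuous (fun y => f y + c).
  by move=> y; apply: cvgD; [exact: cf|exact: cvg_cst].
have above x : K x ->
    exists2 g, L g & g x < f x + e3 /\ forall y, K y -> f y - e3 < g y.
  move=> Kx.
  have [||z Kz|g [Lg gx] gK] := @compact_lt_max_closed R Y
    (fun g => L g /\ g x < f x + e3) K (fun y => f y - e3) cK.
  - by exists (fun _ => f x); split; [exact/LA/A_cst|rewrite ltrDl].
  - by move=> g h [Lg gx] [Lh hx]; split; [exact: Lmax|rewrite gt_max gx hx].
  - have [g [Ag gx gz]] := interp x z Kx Kz.
    exists g; first by split; [exact: LA|rewrite gx ltrDl].
    by apply: near_lt; [exact: cfD|exact: A_cont|rewrite gz gtrDl oppr_lt0].
  by exists g.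
have [g [[Cg _] fg] gf] : exists2 g, L g /\ (forall y, K y -> f y - e3 < g y) &
    forall y, K y -> g y < f y + e3.
  apply: (@compact_gt_min_closed R Y
    (fun g => L g /\ forall y, K y -> f y - e3 < g y)) => //.
  (* When [K] is empty, [above] supplies no function, but any constant will do. *)
  - have [[x Kx]|K0] := pselect (exists x, K x).
      by have [g Lg [_ gK]] := above x Kx; exists g.
    by exists (fun _ => 0); split; [exact/LA/A_cst|move=> y Ky; case: K0; exists y].
  - move=> g h [Lg gK] [Lh hK]; split; first exact: Lmin.
    by move=> y Ky; rewrite lt_min gK ?hK.
  - move=> x Kx; have [g Lg [gx gK]] := above x Kx; exists g => //.
    by apply: near_lt; [exact: Lg.2|exact: cfD|].
have [h Ah gh] := Cg e3 e30.
exists h => // y Ky.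
have := gh y Ky; have := fg y Ky; have := gf y Ky.
by rewrite !ltr_norml /e3 => *; apply/andP; split; lra.
Qed.

End stone_weierstrass.

(** * Coefficient extraction in the Clifford algebra *)

(** The index of the product of e_A and e_B, spelled as in [clif_mul] so that it can be folded
    there. *)
Definition setSD (T : finType) (A B : {set T}) : {set T} :=
  (A :\: B) :|: (B :\: A).

Lemma in_setSD (T : finType) (A B : {set T}) x :
  (x \in setSD A B) = (x \in A) (+) (x \in B).
Proof. by rewrite !inE; case: (x \in A); case: (x \in B). Qed.

Lemma setSDC (T : finType) (A B : {set T}) : setSD A B = setSD B A.
Proof. by apply/setP => x; rewrite !in_setSD addbC. Qed.

Lemma setSDK (T : finType) (A B : {set T}) : setSD A (setSD A B) = B.
Proof. by apply/setP => x; rewrite !in_setSD addKb. Qed.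

Lemma setSDKr (T : finType) (A B : {set T}) : setSD (setSD A B) B = A.
Proof. by apply/setP => x; rewrite !in_setSD addbK. Qed.

Lemma setSD0 (T : finType) (A : {set T}) : setSD A finset.set0 = A.
Proof. by apply/setP => x; rewrite in_setSD inE addbF. Qed.

Lemma setSD_eq (T : finType) (A B C : {set T}) :
  (setSD A B == C) = (B == setSD A C).
Proof. by apply/eqP/eqP => [<-|->]; rewrite setSDK. Qed.

(** Indices common to [A] and [B] occur twice on the right and contribute squares, equal to 1. *)
Lemma prod_setSD (R : comRingType) (T : finType) (A B : {set T}) (F : T -> R) :
  (forall x, F x * F x = 1) ->
  \prod_(x in setSD A B) F x = (\prod_(x in A) F x) * (\prod_(x in B) F x).
Proof.
move=> F2; rewrite big_mkcond [X in X * _]big_mkcond [X in _ * X]big_mkcond -big_split.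
apply: eq_bigr => x _; rewrite in_setSD /=.
by case: (x \in A); case: (x \in B); rewrite /= ?F2 ?mulr1 ?mul1r.
Qed.

Lemma signr_setSD (R : comRingType) (T : finType) (A B : {set T}) :
  (-1) ^+ #|setSD A B| = (-1) ^+ #|A| * (-1) ^+ #|B| :> R.
Proof. by rewrite -!prodr_const prod_setSD// => x; rewrite mulrNN mulr1. Qed.

(** * Signs of products of basis elements *)

Section clif_sign.
Context (R : realType) (p n : nat).
Implicit Types A B C : {set 'I_n}.

(** The sign in the product of two generators: -1 for reordering, or for a generator of square
    -1. *)
Definition gen_sign (a b : 'I_n) : R :=
  (-1) ^+ ((b < a)%N + ((a == b) && (p <= a)%N)).

Lemma gen_sign_sqr a b : gen_sign a b * gen_sign a b = 1.
Proof. by rewrite -expr2 /gen_sign sqrr_sign. Qed.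

Lemma gen_sign_swap a b : gen_sign a b * gen_sign b a = (-1) ^+ (a != b).
Proof.
rewrite /gen_sign; have [->|ab] := eqVneq a b; first by rewrite -expr2 sqrr_sign.
rewrite /= !addn0 -exprD.
have : (a : nat) != b := ab.
by rewrite neq_ltn => /orP[h|h]; rewrite h ltnNge (ltnW h).
Qed.

(** The intersection term of the exponent counts the diagonal pairs. The product form makes the sign
    a bicharacter of the group of subsets under symmetric difference. *)
Lemma clif_signE A B :
  clif_sign R p A B = \prod_(a in A) \prod_(b in B) gen_sign a b.
Proof.
rewrite /clif_sign exprD -!prodr_const.
under [RHS]eq_bigr => a _ do under eq_bigr => b _ do rewrite /gen_sign exprD.
under [RHS]eq_bigr => a _ do rewrite big_split /=.
rewrite big_split /=; congr (_ * _).
  rewrite pair_big /= big_mkcond [RHS]big_mkcond /=; apply: eq_bigr => -[a b] _ /=.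
  by rewrite inE /=; case: (a \in A); case: (b \in B); case: (b < a)%N.
rewrite big_mkcond [RHS]big_mkcond /=; apply: eq_bigr => a _.
rewrite !inE; have [aA|aA] := boolP (a \in A) => //=.
have [aB|aB] := boolP (a \in B) => /=.
  rewrite (bigD1 a)//= eqxx big1 ?mulr1 => [|b /andP[_ ba]].
    by case: (p <= a)%N.
  by rewrite eq_sym (negbTE ba).
rewrite big1// => b bB; suff /negbTE-> : a != b by [].
by apply: contraNneq aB => ->.
Qed.

Lemma clif_sign_setSDl A B C :
  clif_sign R p (setSD A B) C = clif_sign R p A C * clif_sign R p B C.
Proof.
rewrite !clif_signE prod_setSD// => a.
by rewrite -big_split big1// => b _; exact: gen_sign_sqr.
Qed.

Lemma clif_sign_setSDr A B C :
  clif_sign R p A (setSD B C) = clif_sign R p A B * clif_sign R p A C.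
Proof.
rewrite !clif_signE -big_split; apply: eq_bigr => a _.
by rewrite prod_setSD// => b; exact: gen_sign_sqr.
Qed.

Lemma clif_sign_sqr A B : clif_sign R p A B * clif_sign R p A B = 1.
Proof. by rewrite -expr2 /clif_sign sqrr_sign. Qed.

Lemma clif_sign0l A : clif_sign R p finset.set0 A = 1.
Proof. by rewrite clif_signE big_set0. Qed.

Lemma clif_sign0r A : clif_sign R p A finset.set0 = 1.
Proof. by rewrite clif_signE big1// => a _; rewrite big_set0. Qed.

(** Moving e_b across e_C costs one sign for each generator of e_C other than e_b. *)
Lemma clif_sign_commute1 C b :
  clif_sign R p C [set b]%SET * clif_sign R p [set b]%SET C =
  (-1) ^+ #|C :\ b|%SET.
Proof.
rewrite !clif_signE big_set1 -big_split -prodr_const big_mkcond [RHS]big_mkcond.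
apply: eq_bigr => a _; rewrite big_set1 /= gen_sign_swap !inE andbC.
by case: (a \in C) => //=; case: eqP.
Qed.

(* e_B e_C = (clif_sign C B * clif_sign B C) e_C e_B, so this is a sum of a
   character of the group of subsets; it is trivial only for the C such that
   e_C is central. *)
Lemma sum_clif_sign_commute C : C != finset.set0 -> (odd n -> C != finset.setT) ->
  \sum_(B : {set 'I_n}) clif_sign R p C B * clif_sign R p B C = 0.
Proof.
move=> C0 CT.
(* A generator e_b anticommuting with e_C: [b] in [C] if [C] has even size, [b] outside [C] if odd.
   In the odd case [C] is not full, as otherwise [n] would be odd. *)
have [b Cb] : exists b, odd #|C :\ b|%SET.
  have [oC|eC] := boolP (odd #|C|); last first.
    have /set0Pn[b bC] := C0.
    by exists b; move: eC; rewrite (cardsD1 b C) bC /= negbK.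
  have : C != finset.setT.
    by apply/eqP => CE; move: (oC); rewrite CE cardsT card_ord => /CT; rewrite CE eqxx.
  rewrite -finset.subTset => /subsetPn[b _ bC].
  by exists b; move: oC; rewrite (cardsD1 b C) (negbTE bC).
pose h B := clif_sign R p C B * clif_sign R p B C.
(* Toggling [b] is an involution on subsets that negates each term, so the sum equals its
   opposite. *)
have hN B : h (setSD B [set b]%SET) = - h B.
  rewrite /h clif_sign_setSDr clif_sign_setSDl mulrACA clif_sign_commute1.
  by rewrite -signr_odd Cb expr1 mulrN1.
have inj : bijective (fun B : {set 'I_n} => setSD B [set b]%SET).
  by exists (fun B : {set 'I_n} => setSD B [set b]%SET) => B; rewrite setSDKr.
have : \sum_B h B = - \sum_B h B.
  rewrite [LHS](reindex _ (onW_bij _ inj)) -sumrN.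
  by apply: eq_bigr => B _; rewrite hN.
by rewrite /h; lra.
Qed.

End clif_sign.

(** * Monomials and averaging over conjugations *)

Section monomial.
Context (R : realType) (p n : nat).
Implicit Types (A B C : {set 'I_n}) (a b : clif R n).

Definition clif_mono (r : R) A : clif R n := [ffun C => if C == A then r else 0].

Lemma clif_mul_monol r A b C :
  clif_mul p (clif_mono r A) b C =
  clif_sign R p A (setSD A C) * r * b (setSD A C).
Proof.
rewrite ffunE (bigD1 A)//= [X in _ + X]big1 ?addr0 => [|A' A'A].
  rewrite (eq_bigl (pred1 (setSD A C))) ?big_pred1_eq => [|B].
    by rewrite ffunE eqxx.
  by rewrite -/(setSD A B) setSD_eq.
by apply: big1 => B _; rewrite ffunE (negbTE A'A) mulr0 mul0r.
Qed.

Lemma clif_mul_monor r a B C :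
  clif_mul p a (clif_mono r B) C =
  clif_sign R p (setSD C B) B * a (setSD C B) * r.
Proof.
rewrite ffunE (exchange_big_dep predT)//= (bigD1 B)//= [X in _ + X]big1 ?addr0 => [|B' B'B].
  rewrite (eq_bigl (pred1 (setSD C B))) ?big_pred1_eq => [|A].
    by rewrite ffunE eqxx.
  by rewrite -/(setSD A B) setSDC setSD_eq (setSDC B C).
by apply: big1 => A _; rewrite ffunE (negbTE B'B) mulr0.
Qed.

Lemma clif_mono0M r s A :
  clif_mul p (clif_mono r finset.set0) (clif_mono s A) = clif_mono (r * s) A.
Proof.
apply/ffunP => C; rewrite clif_mul_monol clif_sign0l setSDC setSD0 !ffunE mul1r.
by case: eqP => // _; rewrite mulr0.
Qed.

Lemma clif_monoD r s A :
  clif_add (clif_mono r A) (clif_mono s A) = clif_mono (r + s) A.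
Proof. by apply/ffunP => C; rewrite !ffunE; case: eqP => // _; rewrite addr0. Qed.

(* The factor clif_sign B B turns the right factor e_B into e_B^-1 *)
Lemma clif_conj_average a : (odd n -> a finset.setT = 0) ->
  [ffun C => \sum_(B : {set 'I_n})
     clif_mul p (clif_mul p (clif_mono 1 B) a)
       (clif_mono (clif_sign R p B B / #|{set 'I_n}|%:R) B) C] =
  clif_mono (a finset.set0) finset.set0.
Proof.
move=> aT; apply/ffunP => C; rewrite !ffunE.
have N0 : #|{set 'I_n}|%:R != 0 :> R.
  by rewrite pnatr_eq0 -lt0n; apply/card_gt0P; exists finset.set0.
transitivity (\sum_(B : {set 'I_n}) (clif_sign R p C B * clif_sign R p B C) *
    (a C / #|{set 'I_n}|%:R)).
  apply: eq_bigr => B _; rewrite clif_mul_monor clif_mul_monol.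
  have -> : setSD B (setSD C B) = C by rewrite (setSDC C) setSDK.
  rewrite clif_sign_setSDl mulr1.
  by transitivity (clif_sign R p B B * clif_sign R p B B *
    (clif_sign R p C B * clif_sign R p B C * (a C / #|{set 'I_n}|%:R)));
    [ring|rewrite clif_sign_sqr mul1r].
rewrite -mulr_suml.
have [->|C0] := eqVneq C finset.set0.
  rewrite (eq_bigr (fun _ => 1)) => [|B _]; last by rewrite clif_sign0l clif_sign0r mulr1.
  by rewrite sumr_const mulrC divfK.
(* For odd [n] the full basis element is central and survives averaging; its coefficient is zero by
   [aT]. *)
have [/andP[on /eqP->]|] := boolP (odd n && (C == finset.setT)).
  by rewrite aT// mul0r mulr0.
rewrite negb_and => nC; rewrite sum_clif_sign_commute ?mul0r// => on.
by move: nC; rewrite on.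
Qed.

End monomial.

(** * Scalar coordinates in the generated algebra *)

Section gen_algebra.
Context (R : realType) (p n : nat) (Y : Type) (B : (Y -> clif R n) -> Prop).

Lemma gen_algebra_base f : B f -> gen_algebra p B f.
Proof. by move=> Bf S SB _ _ _; exact: SB. Qed.

Lemma gen_algebra_cst c : gen_algebra p B (fun _ => c).
Proof. by move=> S _ Sc _ _; exact: Sc. Qed.

Lemma gen_algebra_add f h : gen_algebra p B f -> gen_algebra p B h ->
  gen_algebra p B (fun y => clif_add (f y) (h y)).
Proof. by move=> Gf Gh S SB Sc Sa Sm; exact: (Sa f h (Gf S SB Sc Sa Sm) (Gh S SB Sc Sa Sm)). Qed.

Lemma gen_algebra_mul f h : gen_algebra p B f -> gen_algebra p B h ->
  gen_algebra p B (fun y => clif_mul p (f y) (h y)).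
Proof. by move=> Gf Gh S SB Sc Sa Sm; exact: (Sm f h (Gf S SB Sc Sa Sm) (Gh S SB Sc Sa Sm)). Qed.

Lemma gen_algebra_sum (I : finType) (F : I -> Y -> clif R n) :
  (forall i, gen_algebra p B (F i)) ->
  gen_algebra p B (fun y => [ffun C => \sum_i F i y C]).
Proof.
move=> GF; elim: index_enum => [|i r IH].
  have -> : (fun y : Y => [ffun C => \sum_(j <- [::]) F j y C]) =
            (fun _ => [ffun _ => 0] : clif R n).
    by apply/funext => y; apply/ffunP => C; rewrite !ffunE big_nil.
  exact: gen_algebra_cst.
have -> : (fun y : Y => [ffun C => \sum_(j <- i :: r) F j y C]) =
          (fun y => clif_add (F i y) [ffun C => \sum_(j <- r) F j y C]).
  by apply/funext => y; apply/ffunP => C; rewrite !ffunE big_cons.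
exact: gen_algebra_add.
Qed.

Lemma gen_algebra_coef f (A : {set 'I_n}) :
  (odd n -> forall f, B f -> B (fun y => clif_star (f y))) -> B f ->
  gen_algebra p B (fun y => clif_mono (f y A) finset.set0).
Proof.
move=> Bstar Bf.
(* Left multiplication by the inverse of e_A moves the [A]-coordinate of [f] to the scalar position,
   from which averaging isolates it. *)
have [h [Gh hA hT]] : exists h, [/\ gen_algebra p B h,
    forall y, h y finset.set0 = f y A & odd n -> forall y, h y finset.setT = 0].
  have [on|en] := boolP (odd n); last first.
    exists (fun y => clif_mul p (clif_mono (clif_sign R p A A) A) (f y)); split => //.
    - apply: gen_algebra_mul; first exact: gen_algebra_cst.
      exact: gen_algebra_base.
    - by move=> y; rewrite clif_mul_monol setSD0 clif_sign_sqr mul1r.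
  (* First project [f] onto degrees of the parity of [#|A|], as half of f + (-1)^|A| f_*. The full
     coordinate of the product comes from the complement of [A], whose size has the other parity
     when [n] is odd, so it cancels. *)
  pose s := clif_sign R p A A / 2.
  exists (fun y => clif_add (clif_mul p (clif_mono s A) (f y))
    (clif_mul p (clif_mono ((-1) ^+ #|A| * s) A) (clif_star (f y)))); split.
  - apply: gen_algebra_add; apply: gen_algebra_mul; try exact: gen_algebra_cst.
      exact: gen_algebra_base.
    by apply: gen_algebra_base; exact: Bstar.
  - move=> y; rewrite ffunE !clif_mul_monol setSD0 ffunE /s.
    transitivity (clif_sign R p A A * clif_sign R p A A *
      (1 + (-1) ^+ #|A| * (-1) ^+ #|A|) / 2 * f y A); first by ring.
    by rewrite clif_sign_sqr -expr2 sqrr_sign; lra.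
  - move=> _ y; rewrite ffunE !clif_mul_monol ffunE signr_setSD.
    rewrite finset.cardsT card_ord -(signr_odd _ n) on expr1.
    set t := f y _; set u := clif_sign _ _ _ _.
    transitivity (u * s * t * (1 - (-1) ^+ #|A| * (-1) ^+ #|A|)); first by ring.
    by rewrite -expr2 sqrr_sign subrr mulr0.
have -> : (fun y => clif_mono (f y A) finset.set0) =
    (fun y => [ffun C => \sum_(D : {set 'I_n})
     clif_mul p (clif_mul p (clif_mono 1 D) (h y))
       (clif_mono (clif_sign R p D D / #|{set 'I_n}|%:R) D) C]).
  by apply/funext => y; rewrite clif_conj_average ?hA// => on; exact: hT.
apply: gen_algebra_sum => D; apply: gen_algebra_mul; last exact: gen_algebra_cst.
by apply: gen_algebra_mul => //; exact: gen_algebra_cst.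
Qed.

End gen_algebra.

(** * Density by coordinatewise approximation *)

Unset Implicit Arguments.
Set Strict Implicit.
Set Printing Implicit Defensive.

Theorem theorem3 (R : realType) (p q : nat) (Y : metricType R)
  (B : (Y -> clif R (p + q)) -> Prop) :
  (1 <= p + q)%N ->
  (forall f, B f -> clif_continuous f) ->
  B (fun _ => clif_one R (p + q)) ->
  (forall x y : Y, x <> y -> exists2 f, B f & f x <> f y) ->
  (odd (p + q) -> forall f, B f -> B (fun y => clif_star (f y))) ->
  forall f : Y -> clif R (p + q), clif_continuous f ->
  forall K : set Y, compact K ->
  forall eps : R, 0 < eps ->
  exists2 g, gen_algebra p B g &
    forall y, K y -> clif_norm [ffun A => f y A - g y A] < eps.
Proof.
move=> _ Bcont _ Bsep Bstar f fcont K cK e e0.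
pose A (u : Y -> R) :=
  gen_algebra p B (fun y => clif_mono (u y) finset.set0) /\ continuous u.
have approx C : exists2 u : Y -> R, A u & forall y, K y -> `|f y C - u y| < e.
  apply: (stone_weierstrass (A := A) cK) => //.
  - by move=> g [].
  - by move=> c; split; [exact: gen_algebra_cst|move=> y; exact: cvg_cst].
  - move=> g h [Gg cg] [Gh ch]; split.
      under [X in gen_algebra _ _ X]funext => y do rewrite -clif_monoD.
      exact: gen_algebra_add.
    by move=> y; apply: cvgD; [exact: cg|exact: ch].
  - move=> g h [Gg cg] [Gh ch]; split.
      under [X in gen_algebra _ _ X]funext => y do rewrite -(clif_mono0M p).
      exact: gen_algebra_mul.
    by move=> y; apply: cvgM; [exact: cg|exact: ch].
  (* Distinct Clifford values differ in some coordinate, and that coordinate function belongs to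
     [A]. *)
  - move=> x y _ _ /Bsep[g Bg gxy].
    have [D gD] : exists D, g x D <> g y D.
      apply: contrapT => /forallNP gD; apply: gxy; apply/ffunP => D.
      exact: contrapT (gD D).
    exists (fun z => g z D) => //; split; last exact: Bcont.
    exact: gen_algebra_coef.
have /choice[u uP] C : exists u, A u /\ forall y, K y -> `|f y C - u y| < e.
  by have [u] := approx C; exists u.
(* Reassemble the scalar approximants as the sum of the u_D e_D. As [clif_norm] is a maximum, an
   error below [e] in each coordinate suffices. *)
exists (fun y => [ffun C => \sum_(D : {set 'I_(p + q)})
    clif_mul p (clif_mono (u D y) finset.set0) (clif_mono 1 D) C]).
  apply: gen_algebra_sum => D; apply: gen_algebra_mul; last exact: gen_algebra_cst.
  by have [[]] := uP D.
move=> y Ky; apply/bigmax_ltP; split=> // C _; rewrite !ffunE.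
rewrite (bigD1 C)//= big1 ?addr0 => [|D DC].
  by rewrite clif_mono0M ffunE eqxx mulr1; have [_] := uP C; exact.
by rewrite clif_mono0M ffunE eq_sym (negbTE DC).
Qed.
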